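(* If $\lambda$ is a Cherednik diagram of degree $n$, then the operator of right multiplication in $\mathcal H_n$ by the element $E_\lambda$ is an intertwining operator $I_{\chi_\lambda}\to I_{w_0\cdot\chi_\lambda}$ of $\widetilde{\mathcal H}_n$-modules.
   Context: **Hecke algebras.** $q$ is a formal parameter. $\mathcal H_n$ is the associative $\mathbb C(q)$-algebra with generators $T_1,\ldots,T_{n-1}$ and relations $T_kT_{k+1}T_k=T_{k+1}T_kT_{k+1}$ for $1\le k\le n-2$; $T_kT_l=T_lT_k$ for $|k-l|>1$; $(T_k-q)(T_k+1)=0$ for $1\le k\le n-1$. The affine Hecke algebra $\widetilde{\mathcal H}_n$ is the associative $\mathbb C(q)$-algebra generated by $T_1,\ldots,T_{n-1}$ subject to these relations and by invertible elements $X_1,\ldots,X_n$ such that $X_kX_l=X_lX_k$; $X_lT_k=T_kX_l$ for $l\neq k,k+1$; $T_kX_kT_k=q\,X_{k+1}$ for $1\le k\le n-1$. $\mathcal A_n\subset\widetilde{\mathcal H}_n$ is the subalgebra generated by $X_1^{\pm1},\ldots,X_n^{\pm1}$. For an algebra character $\chi:\mathcal A_n\to\mathbb C(q)$, $I_\chi$ is the $\widetilde{\mathcal H}_n$-module induced from $\chi$; its underlying space is identified with $\mathcal H_n$, on which $\mathcal H_n$ acts by left multiplication and $X_k\cdot1=\chi(X_k)$. $\mathcal S_n$ acts on characters by $(w\cdot\chi)(X_k)=\chi(X_{w^{-1}(k)})$. $s_k=(k,k+1)$ and $w_0$ is the longest element of $\mathcal S_n$. **Cherednik diagrams.** A diagram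 $\lambda=(\lambda_1,\ldots,\lambda_r)$ with rows $\lambda_i=[a_i,b_i]$ (integers $a_i\le b_i$) is the set of boxes $\{(i,j)\in\mathbb Z^2\mid 1\le i\le r,\ a_i\le j\le b_i\}$; its degree is $n=\sum_i(b_i-a_i+1)$. It is a Cherednik diagram if for each $i=1,\ldots,r-1$ either $b_{i+1}\le b_i$, or $b_{i+1}=b_i+1$ and $a_{i+1}\le a_i+1$. The row filling $\Lambda$ is obtained by filling the boxes with $1,\ldots,n$, row by row from left to right and then from top (row $1$) to bottom (row $r$). The content of the box $(i,j)$ is $j-i$, and $c_k$ is the content of the box filled with $k$ in $\Lambda$. Rows $\lambda_i,\lambda_j$ are parallel if $a_i-i=a_j-j$ and $b_i-i=b_j-j$. The character $\chi_\lambda$ of $\mathcal A_n$ is defined by $\chi_\lambda(X_k)=q^{c_k}$. **The element $E_\lambda$.** Put $\langle x\rangle=(1-q)/(1-x)$ and $\varphi_k(x_1,\ldots,x_n)=T_k+\langle x_{k+1}/x_k\rangle$. For $w\in\mathcal S_n$ and an $\mathcal H_n$-valued rational function $\psi$ put ${}^w\psi(x_1,\ldots,x_n)=\psi(x_{w(1)},\ldots,x_{w(n)})$. For a reduced decomposition $w_0=s_{k_1}\cdots s_{k_m}$ put $\varphi_0=\varphi_{k_1}({}^{s_{k_1}}\varphi_{k_2})\cdots({}^{s_{k_1}\cdots s_{k_{m-1}}}\varphi_{k_m})$, which is independent of the choice of the decomposition. $\delta_\lambda(x_1,\ldots,x_n)$ is the product of $1-x_l/x_k$ over all $k<l$ occurring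 in $\Lambda$ in the leftmost boxes of two parallel rows of $\lambda$ ($\delta_\lambda=1$ if there are none). $\mathcal F_\lambda\subset\mathbb C(q)^{\times n}$ is the affine subspace of points with $x_kq^{c_l}=q^{c_k}x_l$ whenever $k,l$ are in the same row of $\Lambda$. The restriction of $\delta_\lambda\varphi_0$ to $\mathcal F_\lambda$ is regular (and non-zero) at $(q^{c_1},\ldots,q^{c_n})$, and $E_\lambda\in\mathcal H_n$ is its value there. *)

(* Defs.v *)
From HB Require Import structures.
From mathcomp Require Import all_boot all_order all_algebra all_fingroup.
From mathcomp Require Import ring_quotient generic_quotient.
From mathcomp Require Import complex boolp reals.
From mathcomp Require Import finmap monalg.

Set Implicit Arguments.
Unset Strict Implicit.
Unset Printing Implicit Defensive.

Import GRing.Theory.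
Local Open Scope ring_scope.
Local Open Scope quotient_scope.

Section LeftIdealQuotient.
Variables (A : nzRingType) (S : A -> Prop).

Definition left_ideal : {pred A} := fun x =>
  `[< exists s : seq (A * A),
        (forall t, t \in s -> S t.2) /\ x = \sum_(t <- s) t.1 * t.2 >].

Lemma left_idealM a x : x \in left_ideal -> a * x \in left_ideal.
Proof.
move=> /asboolP[s [sS ->]]; apply/asboolP.
exists [seq (a * t.1, t.2) | t <- s]; split.
  by move=> _ /mapP[t ts ->] /=; exact: sS.
by rewrite big_map mulr_sumr; apply: eq_bigr => t _; rewrite mulrA.
Qed.

Lemma left_ideal_zmod : zmod_closed left_ideal.
Proof.
split; first by apply/asboolP; exists [::]; rewrite big_nil.
move=> x y xI /(left_idealM (-1)); rewrite mulN1r.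
move: xI => /asboolP[s [sS ->]] /asboolP[t [tS ->]]; apply/asboolP.
exists (s ++ t); rewrite big_cat; split => // z.
by rewrite mem_cat => /orP[/sS|/tS].
Qed.

HB.instance Definition _ := GRing.isZmodClosed.Build A left_ideal
  left_ideal_zmod.

Definition left_quot := Quotient.quot left_ideal.
HB.instance Definition _ := GRing.Zmodule.on left_quot.

Definition left_proj (a : A) : left_quot := \pi_(Quotient.quot left_ideal) a.

Lemma left_projK (u : left_quot) : left_proj (repr u) = u.
Proof. exact: reprK. Qed.

Lemma left_projP a b : (left_proj a = left_proj b) <-> (a - b \in left_ideal).
Proof. by rewrite Quotient.idealrBE; split=> /eqP. Qed.

Lemma left_projB : {morph left_proj : a b / a - b}.
Proof. by move=> a b; rewrite /left_proj !piE. Qed.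
HB.instance Definition _ := GRing.isZmodMorphism.Build A left_quot left_proj
  left_projB.

Definition left_scale (a : A) (u : left_quot) : left_quot :=
  locked (left_proj (a * repr u)).

Lemma left_scaleE a b : left_scale a (left_proj b) = left_proj (a * b).
Proof.
rewrite /left_scale -lock; apply/left_projP; rewrite -mulrBr; apply: left_idealM.
by apply/left_projP; rewrite left_projK.
Qed.

Lemma left_scaleA a b u : left_scale a (left_scale b u) = left_scale (a * b) u.
Proof. by rewrite -(left_projK u) !left_scaleE mulrA. Qed.
Lemma left_scale1 : left_id 1 left_scale.
Proof. by move=> u; rewrite -(left_projK u) left_scaleE mul1r. Qed.
Lemma left_scaleDr : right_distributive left_scale +%R.
Proof.
move=> a u v; rewrite -(left_projK u) -(left_projK v) -raddfD !left_scaleE.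
by rewrite mulrDr raddfD.
Qed.
Lemma left_scaleDl u : {morph left_scale^~ u : a b / a + b}.
Proof.
by move=> a b; rewrite -(left_projK u) !left_scaleE mulrDl raddfD.
Qed.
HB.instance Definition _ := GRing.Zmodule_isLmodule.Build A left_quot
  left_scaleA left_scale1 left_scaleDr left_scaleDl.

End LeftIdealQuotient.

Section AlgebraQuotient.
Variables (K : fieldType) (A : algType K).

Definition two_sided_ideal (S : A -> A -> Prop) : {pred A} := fun x =>
  `[< exists s : seq (A * (A * A) * A),
        (forall t, t \in s -> S t.1.2.1 t.1.2.2) /\
        x = \sum_(t <- s) t.1.1 * (t.1.2.1 - t.1.2.2) * t.2 >].

(* Consistency is what gives the quotient a structure of nonzero ring, as
   MathComp algebras require. *)
Record relations := Relations {
  rel_of :> A -> A -> Prop;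
  rel_consistent : 1 \notin two_sided_ideal rel_of }.

Section Ideal.
Variable S : A -> A -> Prop.

Lemma two_sided_idealM a x b :
  x \in two_sided_ideal S -> a * x * b \in two_sided_ideal S.
Proof.
move=> /asboolP[s [sS ->]]; apply/asboolP.
exists [seq (a * t.1.1, t.1.2, t.2 * b) | t <- s]; split.
  by move=> _ /mapP[t ts ->] /=; exact: sS.
rewrite big_map mulr_sumr mulr_suml; apply: eq_bigr => t _ /=.
by rewrite !mulrA.
Qed.

Lemma two_sided_ideal_rel u v : S u v -> u - v \in two_sided_ideal S.
Proof.
move=> Suv; apply/asboolP; exists [:: (1, (u, v), 1)]; split.
  by move=> t; rewrite inE => /eqP->.
by rewrite big_seq1 mul1r mulr1.
Qed.

Lemma two_sided_ideal_zmod : zmod_closed (two_sided_ideal S).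
Proof.
split; first by apply/asboolP; exists [::]; rewrite big_nil.
move=> x y xI /(two_sided_idealM (-1) 1); rewrite mulN1r mulr1.
move: xI => /asboolP[s [sS ->]] /asboolP[t [tS ->]]; apply/asboolP.
exists (s ++ t); rewrite big_cat; split => // z.
by rewrite mem_cat => /orP[/sS|/tS].
Qed.

HB.instance Definition _ := GRing.isZmodClosed.Build A (two_sided_ideal S)
  two_sided_ideal_zmod.
End Ideal.

Variable S : relations.

Definition alg_quot := Quotient.quot (two_sided_ideal S).
HB.instance Definition _ := GRing.Zmodule.on alg_quot.

Definition alg_proj (a : A) : alg_quot := \pi_(Quotient.quot (two_sided_ideal S)) a.

Lemma alg_projK (u : alg_quot) : alg_proj (repr u) = u.
Proof. exact: reprK. Qed.

Lemma alg_projP a b :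
  (alg_proj a = alg_proj b) <-> (a - b \in two_sided_ideal S).
Proof. by rewrite Quotient.idealrBE; split=> /eqP. Qed.

Lemma alg_proj_rel a b : S a b -> alg_proj a = alg_proj b.
Proof. by move=> Sab; apply/alg_projP; exact: two_sided_ideal_rel. Qed.

Lemma alg_projB : {morph alg_proj : a b / a - b}.
Proof. by move=> a b; rewrite /alg_proj !piE. Qed.
HB.instance Definition _ := GRing.isZmodMorphism.Build A alg_quot alg_proj
  alg_projB.

Definition alg_quot_mul (u v : alg_quot) : alg_quot :=
  locked (alg_proj (repr u * repr v)).

Lemma alg_quot_mulE a b :
  alg_quot_mul (alg_proj a) (alg_proj b) = alg_proj (a * b).
Proof.
have /alg_projP ha := alg_projK (alg_proj a).
have /alg_projP hb := alg_projK (alg_proj b).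
rewrite /alg_quot_mul -lock; apply/alg_projP; set a' := repr _ in ha *; set b' := repr _ in hb *.
rewrite -[X in X \in _](_ : (1 * (a' - a) * b' + a * (b' - b) * 1) = _).
  by rewrite rpredD //; exact: two_sided_idealM.
by rewrite mul1r mulr1 mulrBl mulrBr addrA subrK.
Qed.

Lemma alg_quot_mulA : associative alg_quot_mul.
Proof.
move=> u v w; rewrite -(alg_projK u) -(alg_projK v) -(alg_projK w).
by rewrite !alg_quot_mulE mulrA.
Qed.
Lemma alg_quot_mul1 : left_id (alg_proj 1) alg_quot_mul.
Proof. by move=> u; rewrite -(alg_projK u) alg_quot_mulE mul1r. Qed.
Lemma alg_quot_mulr1 : right_id (alg_proj 1) alg_quot_mul.
Proof. by move=> u; rewrite -(alg_projK u) alg_quot_mulE mulr1. Qed.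
Lemma alg_quot_mulDl : left_distributive alg_quot_mul +%R.
Proof.
move=> u v w; rewrite -(alg_projK u) -(alg_projK v) -(alg_projK w).
by rewrite -raddfD !alg_quot_mulE mulrDl raddfD.
Qed.
Lemma alg_quot_mulDr : right_distributive alg_quot_mul +%R.
Proof.
move=> u v w; rewrite -(alg_projK u) -(alg_projK v) -(alg_projK w).
by rewrite -raddfD !alg_quot_mulE mulrDr raddfD.
Qed.
Lemma alg_quot_1neq0 : alg_proj 1 != 0.
Proof.
apply/eqP; rewrite -(raddf0 alg_proj) => /alg_projP.
by rewrite subr0; apply/negP; exact: rel_consistent.
Qed.
HB.instance Definition _ := GRing.Zmodule_isNzRing.Build alg_quot
  alg_quot_mulA alg_quot_mul1 alg_quot_mulr1 alg_quot_mulDl alg_quot_mulDr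
  alg_quot_1neq0.

Lemma alg_proj_monoid : monoid_morphism alg_proj.
Proof. by split=> // a b; rewrite -alg_quot_mulE. Qed.
HB.instance Definition _ := GRing.isMonoidMorphism.Build A alg_quot alg_proj
  alg_proj_monoid.

Definition alg_quot_scale (c : K) (u : alg_quot) : alg_quot :=
  locked (alg_proj (c%:A * repr u)).

Lemma alg_quot_scaleE c a : alg_quot_scale c (alg_proj a) = alg_proj (c *: a).
Proof.
by rewrite /alg_quot_scale -lock rmorphM /= alg_projK -rmorphM mulr_algl.
Qed.
Lemma alg_quot_scaleA c d u :
  alg_quot_scale c (alg_quot_scale d u) = alg_quot_scale (c * d) u.
Proof. by rewrite -(alg_projK u) !alg_quot_scaleE scalerA. Qed.
Lemma alg_quot_scale1 : left_id 1 alg_quot_scale.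
Proof. by move=> u; rewrite -(alg_projK u) alg_quot_scaleE scale1r. Qed.
Lemma alg_quot_scaleDr : right_distributive alg_quot_scale +%R.
Proof.
move=> c u v; rewrite -(alg_projK u) -(alg_projK v) -raddfD !alg_quot_scaleE.
by rewrite scalerDr raddfD.
Qed.
Lemma alg_quot_scaleDl u : {morph alg_quot_scale^~ u : c d / c + d}.
Proof.
by move=> c d; rewrite -(alg_projK u) !alg_quot_scaleE scalerDl raddfD.
Qed.
HB.instance Definition _ := GRing.Zmodule_isLmodule.Build K alg_quot
  alg_quot_scaleA alg_quot_scale1 alg_quot_scaleDr alg_quot_scaleDl.

Lemma alg_proj_scalable : scalable alg_proj.
Proof. by move=> c a; rewrite -alg_quot_scaleE. Qed.
HB.instance Definition _ := GRing.isScalable.Build K A alg_quot *:%R alg_proj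
  alg_proj_scalable.

Lemma alg_quot_scaleAl c (u v : alg_quot) : c *: (u * v) = c *: u * v.
Proof.
rewrite -(alg_projK u) -(alg_projK v) -rmorphM -!linearZ -rmorphM /=.
by rewrite scalerAl.
Qed.
Lemma alg_quot_scaleAr c (u v : alg_quot) : c *: (u * v) = u * (c *: v).
Proof.
rewrite -(alg_projK u) -(alg_projK v) -rmorphM -!linearZ -rmorphM /=.
by rewrite scalerAr.
Qed.
HB.instance Definition _ := GRing.Lmodule_isLalgebra.Build K alg_quot
  alg_quot_scaleAl.
HB.instance Definition _ := GRing.Lalgebra_isAlgebra.Build K alg_quot
  alg_quot_scaleAr.

End AlgebraQuotient.

Lemma relations_consistent (K : fieldType) (A B : algType K)
    (S : A -> A -> Prop) (phi : {rmorphism A -> B}) :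
  (forall u v, S u v -> phi u = phi v) -> 1 \notin two_sided_ideal S.
Proof.
move=> phiS; apply/negP => /asboolP[s [sS s1]].
have : phi 1 = 0.
  rewrite s1 rmorph_sum big_seq big1 // => t ts /=.
  by rewrite !rmorphM rmorphB /= (phiS _ _ (sS _ ts)) subrr mulr0 mul0r.
by rewrite rmorph1 => /eqP; rewrite oner_eq0.
Qed.

(* The product of the monoid algebra is locked: unfolding it makes conversion
   between distinct products intractable. *)
HB.lock Definition free_mul (K : fieldType) (G : choiceType)
  (u v : {malg K[{fmonom G}]}) : {malg K[{fmonom G}]} := u * v.

Section FreeAlgebra.
Variables (K : fieldType) (G : choiceType).
Local Notation M := {malg K[{fmonom G}]}.

Definition free_alg := M.
HB.instance Definition _ := GRing.Lmodule.on free_alg.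

Lemma free_mulE (u v : M) : free_mul u v = u * v.
Proof. by rewrite free_mul.unlock. Qed.

Lemma free_mulA : associative (@free_mul K G).
Proof. by move=> u v w; rewrite !free_mulE mulrA. Qed.
Lemma free_mul1 : left_id (1 : M) (@free_mul K G).
Proof. by move=> u; rewrite free_mulE mul1r. Qed.
Lemma free_mulr1 : right_id (1 : M) (@free_mul K G).
Proof. by move=> u; rewrite free_mulE mulr1. Qed.
Lemma free_mulDl : left_distributive (@free_mul K G) +%R.
Proof. by move=> u v w; rewrite !free_mulE mulrDl. Qed.
Lemma free_mulDr : right_distributive (@free_mul K G) +%R.
Proof. by move=> u v w; rewrite !free_mulE mulrDr. Qed.
Lemma free_1neq0 : (1 : M) != 0.
Proof. exact: oner_neq0. Qed.
HB.instance Definition _ := GRing.Zmodule_isNzRing.Build free_alg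
  free_mulA free_mul1 free_mulr1 free_mulDl free_mulDr free_1neq0.

Lemma free_scaleAl c (u v : M) : c *: free_mul u v = free_mul (c *: u) v.
Proof. by rewrite !free_mulE scalerAl. Qed.
Lemma free_scaleAr c (u v : M) : c *: free_mul u v = free_mul u (c *: v).
Proof.
rewrite !free_mulE; apply/malgP => m; rewrite [LHS]mcoeffZ [in LHS]mcoeffMl.
rewrite [RHS](mcoeffMlw _ (fsubset_refl (msupp u)) (msuppZ_le c v)) mulr_sumr.
apply: eq_bigr => k _; rewrite mulr_sumr; apply: eq_bigr => l _.
by rewrite [in RHS]mcoeffZ mulrnAr mulrCA.
Qed.
HB.instance Definition _ := GRing.Lmodule_isLalgebra.Build K free_alg
  free_scaleAl.
HB.instance Definition _ := GRing.Lalgebra_isAlgebra.Build K free_alg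
  free_scaleAr.

End FreeAlgebra.

HB.lock Definition fgen (K : fieldType) (G : choiceType) (g : G) :
  free_alg K G := mkmalgU (fmu g) 1.

Section FreeAlgebra.
Variables (K : fieldType) (G : choiceType).
Local Notation free_alg := (free_alg K G).
Local Notation fgen := (@fgen K G).

Section Eval.
Variables (B : algType K) (f : G -> B).

Definition word_eval (m : {fmonom G}) : B := \prod_(g <- m) f g.

Lemma word_eval_mmorphism : mmorphism word_eval.
Proof.
split; first by move=> m1 m2; rewrite /word_eval fmM big_cat.
by rewrite /word_eval fm1 big_nil.
Qed.
HB.instance Definition _ := monalg.isMultiplicative.Build {fmonom G} B word_eval
  word_eval_mmorphism.

Definition free_eval : free_alg -> B := mmap (in_alg B) word_eval.
HB.instance Definition _ := GRing.Additive.on free_eval.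

Lemma free_eval_monoid : monoid_morphism free_eval.
Proof.
have [eM e1] := commr_mmap_is_multiplicative (f := in_alg B) (h := word_eval)
  (fun u m m' => comm_alg _ _).
by split=> // u v; rewrite -eM -free_mulE.
Qed.
HB.instance Definition _ := GRing.isMonoidMorphism.Build free_alg B free_eval
  free_eval_monoid.

Lemma free_eval_scalable : scalable free_eval.
Proof. by move=> c u; rewrite /free_eval mmapZ /= mulr_algl. Qed.
HB.instance Definition _ := GRing.isScalable.Build K free_alg B *:%R free_eval
  free_eval_scalable.

Lemma free_eval_gen g : free_eval (fgen g) = f g.
Proof.
by rewrite fgen.unlock /free_eval mmapU /= scale1r mul1r /= /word_eval fmU big_seq1.
Qed.

Definition respects (S : free_alg -> free_alg -> Prop) :=
  forall u v, S u v -> free_eval u = free_eval v.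

Definition pres_lift (S : relations free_alg) of respects S :=
  fun u : alg_quot S => free_eval (repr u).

Section Lift.
Variables (S : relations free_alg) (fS : respects S).

Lemma pres_liftE a : pres_lift fS (alg_proj S a) = free_eval a.
Proof.
have /alg_projP/asboolP[s [sS e]] := alg_projK (alg_proj S a).
apply/eqP; rewrite -subr_eq0 /pres_lift -rmorphB /= e rmorph_sum big_seq big1 //.
by move=> t ts; rewrite !rmorphM rmorphB /= (fS (sS _ ts)) subrr mulr0 mul0r.
Qed.

Lemma pres_lift_gen g : pres_lift fS (alg_proj S (fgen g)) = f g.
Proof. by rewrite pres_liftE free_eval_gen. Qed.

Lemma pres_lift_zmod : zmod_morphism (pres_lift fS).
Proof.
move=> u v; rewrite -(alg_projK u) -(alg_projK v) -raddfB !pres_liftE.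
exact: raddfB.
Qed.
HB.instance Definition _ := GRing.isZmodMorphism.Build (alg_quot S) B
  (pres_lift fS) pres_lift_zmod.

Lemma pres_lift_monoid : monoid_morphism (pres_lift fS).
Proof.
split; first by rewrite -(rmorph1 (alg_proj S)) pres_liftE rmorph1.
move=> u v; rewrite -(alg_projK u) -(alg_projK v) -rmorphM !pres_liftE.
exact: rmorphM.
Qed.
HB.instance Definition _ := GRing.isMonoidMorphism.Build (alg_quot S) B
  (pres_lift fS) pres_lift_monoid.

Lemma pres_lift_scalable : scalable (pres_lift fS).
Proof.
move=> c u; rewrite -(alg_projK u) -linearZ !pres_liftE.
exact: linearZ.
Qed.
HB.instance Definition _ := GRing.isScalable.Build K (alg_quot S) B *:%R
  (pres_lift fS) pres_lift_scalable.
End Lift.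

End Eval.
End FreeAlgebra.

(* Everything is indexed from 0: the generators T_1, ..., T_{n-1} by 'I_n.-1,
   the X_1, ..., X_n and the entries 1, ..., n of a filling by 'I_n. *)
Definition lo n (k : 'I_n.-1) : 'I_n := widen_ord (leq_pred n) k.
Definition hi n (k : 'I_n.-1) : 'I_n :=
  Ordinal (etrans (esym (ltn_predRL k n)) (ltn_ord k)).

Section HeckeRelations.
Variables (K : fieldType) (q : K) (n : nat) (A : algType K).
Variables (T : 'I_n.-1 -> A) (X Xinv : 'I_n -> A).

Inductive hecke_rel : A -> A -> Prop :=
| hecke_braid (k l : 'I_n.-1) of l = k.+1 :> nat :
    hecke_rel (T k * T l * T k) (T l * T k * T l)
| hecke_comm (k l : 'I_n.-1) of (k.+1 < l)%N || (l.+1 < k)%N :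
    hecke_rel (T k * T l) (T l * T k)
| hecke_quad k : hecke_rel ((T k - q%:A) * (T k + 1)) 0.

Inductive affine_rel : A -> A -> Prop :=
| affine_hecke u v of hecke_rel u v : affine_rel u v
| affine_mulV k : affine_rel (X k * Xinv k) 1
| affine_mulVl k : affine_rel (Xinv k * X k) 1
| affine_XX k l : affine_rel (X k * X l) (X l * X k)
| affine_XT l k of l != lo k & l != hi k : affine_rel (X l * T k) (T k * X l)
| affine_TXT k : affine_rel (T k * X (lo k) * T k) (q *: X (hi k)).

End HeckeRelations.

Lemma hecke_rel_morph (K : fieldType) (q : K) n (A B : algType K)
    (phi : {lrmorphism A -> B}) (T : 'I_n.-1 -> A) (T' : 'I_n.-1 -> B) :
  (forall k, phi (T k) = T' k) ->
  forall u v, hecke_rel q T u v -> hecke_rel q T' (phi u) (phi v).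
Proof.
move=> phiT u v [k l kl|k l kl|k].
- by rewrite !rmorphM /= !phiT; exact: hecke_braid.
- by rewrite !rmorphM /= !phiT; exact: hecke_comm.
rewrite rmorphM rmorphB rmorphD rmorph0 rmorph1 /= linearZ /= rmorph1 phiT.
exact: hecke_quad.
Qed.

Lemma hecke_rel_const (K : fieldType) (q t : K) n (u v : K^o) :
  (t - q) * (t + 1) = 0 ->
  hecke_rel q (fun _ : 'I_n.-1 => t : K^o) u v -> u = v.
Proof.
by move=> t0 [] // _; rewrite -[q%:A]/(q * 1) mulr1.
Qed.

Section Hecke.
Variables (K : fieldType) (q : K) (n : nat).

Definition hecke_free_rel := hecke_rel q (@fgen K 'I_n.-1).

Lemma hecke_consistent : 1 \notin two_sided_ideal hecke_free_rel.
Proof.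
have phiT k := free_eval_gen (fun _ : 'I_n.-1 => - 1 : K^o) k.
apply: (relations_consistent
  (phi := free_eval (fun _ : 'I_n.-1 => - 1 : K^o))) => u v.
move=> /(hecke_rel_morph phiT); apply: hecke_rel_const.
by rewrite addNr mulr0.
Qed.

Definition hecke_relations := Relations hecke_consistent.
Definition Hecke := alg_quot hecke_relations.
HB.instance Definition _ := GRing.Algebra.on Hecke.

Definition Tgen (k : 'I_n.-1) : Hecke := alg_proj _ (fgen K k).

End Hecke.

Section AffineHecke.
Variables (K : fieldType) (q : K) (q_neq0 : q != 0) (n : nat).

(* Generators: T_k, X_k and the inverse of X_k. *)
Definition affine_gen := ('I_n.-1 + ('I_n + 'I_n))%type.
HB.instance Definition _ := Choice.on affine_gen.

Definition affine_free_rel := affine_rel q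
  (fun k => fgen K (inl k : affine_gen))
  (fun k => fgen K (inr (inl k) : affine_gen))
  (fun k => fgen K (inr (inr k) : affine_gen)).

Lemma affine_consistent : 1 \notin two_sided_ideal affine_free_rel.
Proof using q_neq0.
pose f (g : affine_gen) : K^o := match g with
  | inl _ => q | inr (inl k) => q ^+ k | inr (inr k) => q ^- k end.
apply: (relations_consistent (phi := free_eval f)) => u v.
case=> {u v} [u v uv|k|k|k l|l k _ _|k].
- have := hecke_rel_morph (fun k => free_eval_gen f (inl k)) uv.
  by apply: hecke_rel_const; rewrite subrr mul0r.
- by rewrite rmorphM rmorph1 /= !free_eval_gen mulfV // expf_neq0.
- by rewrite rmorphM rmorph1 /= !free_eval_gen mulVf // expf_neq0.
- by rewrite [LHS]rmorphM [RHS]rmorphM /= !free_eval_gen (mulrC (q ^+ l : K)).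
- by rewrite [LHS]rmorphM [RHS]rmorphM /= !free_eval_gen (mulrC (q ^+ l : K)).
rewrite !rmorphM /= free_eval_scalable !free_eval_gen /=.
by rewrite -[RHS]/(q * q ^+ k.+1) exprSr !mulrA.
Qed.

Definition affine_relations := Relations affine_consistent.
Definition AffineHecke := alg_quot affine_relations.
HB.instance Definition _ := GRing.Algebra.on AffineHecke.

Definition Taff (k : 'I_n.-1) : AffineHecke :=
  alg_proj _ (fgen K (inl k : affine_gen)).
Definition Xgen (k : 'I_n) : AffineHecke :=
  alg_proj _ (fgen K (inr (inl k) : affine_gen)).

Lemma Taff_rel x y : hecke_rel q Taff x y -> x = y.
Proof.
have projT u v :=
  @alg_proj_rel _ _ affine_relations u v \o (@affine_hecke _ _ _ _ _ _ _ u v).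
case=> {x y} [k l kl|k l kl|k].
- by have := projT _ _ (hecke_braid _ _ kl); rewrite !rmorphM.
- by have := projT _ _ (hecke_comm _ _ kl); rewrite !rmorphM.
have := projT _ _ (hecke_quad _ _ k).
by rewrite rmorphM rmorphB rmorphD rmorph0 rmorph1 /= alg_proj_scalable rmorph1.
Qed.

Lemma Taff_respects : respects Taff (hecke_relations q n).
Proof.
move=> u v uv; apply: Taff_rel.
exact: (hecke_rel_morph (free_eval_gen Taff) uv).
Qed.

Definition hecke_to_affine : Hecke q n -> AffineHecke :=
  pres_lift (S := hecke_relations q n) Taff_respects.
HB.instance Definition _ := GRing.LRMorphism.on hecke_to_affine.

(* A character of the subalgebra generated by the X_k and their inverses is
   given by its values chi k at the X_k, and its kernel is generated by the
   X_k - chi k: the module induced from it is the quotient of the algebra by the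
   left ideal generated by these elements. *)
Definition induced (chi : 'I_n -> K) :=
  left_quot (fun a : AffineHecke => exists k, a = Xgen k - (chi k)%:A).
HB.instance Definition _ chi := GRing.Lmodule.on (induced chi).

(* The identification of the space of H_n with that of the induced module,
   h |-> h (x) 1; [intertwining] is the linearity over the affine algebra of f
   read through it at both ends. *)
Definition hecke_to_induced chi (h : Hecke q n) : induced chi :=
  left_proj _ (hecke_to_affine h).

Definition intertwining (chi chi' : 'I_n -> K) (f : Hecke q n -> Hecke q n) :=
  exists Phi : {linear induced chi -> induced chi'},
    forall h, Phi (hecke_to_induced chi h) = hecke_to_induced chi' (f h).

End AffineHecke.

(* Imported only now because its names hide those of monalg. *)
From mathcomp Require Import mpoly.

Section Permutations.
Variable n : nat.
Implicit Types (w v : 'S_n) (ks ls : seq 'I_n.-1).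

Definition s_ (k : 'I_n.-1) : 'S_n := tperm (lo k) (hi k).

(* s_{k_1} ... s_{k_m} composed as functions, rightmost first; MathComp
   permutations compose in the opposite order. *)
Definition word_perm ks : 'S_n := foldr (fun k w => (w * s_ k)%g) 1%g ks.

Definition reduced_decomposition w ks :=
  word_perm ks = w /\
  forall ls, word_perm ls = w -> (size ks <= size ls)%N.

Definition longest_element w :=
  forall v ks ls, reduced_decomposition w ks -> reduced_decomposition v ls ->
  (size ls <= size ks)%N.

Definition twist (V : Type) (Y : Type) w (psi : ('I_n -> V) -> Y) :=
  fun x : 'I_n -> V => psi (fun i => x (w i)).

Definition char_act (V : Type) w (chi : 'I_n -> V) : 'I_n -> V :=
  fun k => chi (w^-1%g k).

End Permutations.

Section RationalFunctions.
Variables (K : fieldType) (n : nat) (H : lmodType K).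

(* The restriction to F of the H-valued rational function f is regular at p,
   with value v: on the points of F where f is defined it is a quotient P / Q
   of polynomials, P with coefficients in H, such that Q p != 0. For K infinite
   and [dom] a dense open subset of an affine space F this determines v. *)
Definition regular_value (F dom : ('I_n -> K) -> Prop) (f : ('I_n -> K) -> H)
    (p : 'I_n -> K) (v : H) :=
  exists (Q : mpoly n K) (P : seq (mpoly n K * H)),
    [/\ Q.@[p] != 0,
        forall x, F x -> dom x -> Q.@[x] *: f x = \sum_(t <- P) t.1.@[x] *: t.2
      & Q.@[p] *: v = \sum_(t <- P) t.1.@[p] *: t.2].

End RationalFunctions.

Section Phi.
Variables (K : fieldType) (q : K) (n : nat).
Implicit Types (x : 'I_n -> K).

Definition bracket (y : K) : K := (1 - q) / (1 - y).

Definition phi (k : 'I_n.-1) x : Hecke q n :=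
  Tgen q k + (bracket (x (hi k) / x (lo k)))%:A.

Definition phi0 (ks : seq 'I_n.-1) x : Hecke q n :=
  \prod_(j < size ks)
    twist (word_perm (take j ks)) (phi (tnth (in_tuple ks) j)) x.

(* Points at which none of the denominators x_k, 1 - x_l / x_k vanish. *)
Definition generic_point x := (forall k, x k != 0) /\ injective x.

End Phi.

Section Diagrams.

(* The sequence of the pairs (a_i, b_i). Row and column numbers are the actual
   ones: rows are numbered from 1, which contents depend on. *)
Record diagram := Diagram {
  rows :> seq (int * int);
  rows_nonempty : all (fun r => r.1 <= r.2) rows }.

Variable lam : diagram.

Definition row_start (i : nat) : int := (nth (0, 0) lam i.-1).1.
Definition row_end (i : nat) : int := (nth (0, 0) lam i.-1).2.
Definition row_length (i : nat) : nat := `|(row_end i - row_start i + 1)%R|%N.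

Definition degree : nat := (\sum_(i <- iota 1 (size lam)) row_length i)%N.

Definition cherednik := forall i, (1 <= i < size lam)%N ->
  row_end i.+1 <= row_end i \/
  row_end i.+1 = row_end i + 1 /\ row_start i.+1 <= row_start i + 1.

(* The boxes (i, j) in the order of the row filling. *)
Definition boxes : seq (nat * int) :=
  flatten [seq [seq (i, row_start i + t%:Z) | t <- iota 0 (row_length i)]
          | i <- iota 1 (size lam)].

Definition box (k : 'I_degree) : nat * int := nth (0%N, 0) boxes k.
Definition content (k : 'I_degree) : int := (box k).2 - (box k).1%:Z.
Definition leftmost (k : 'I_degree) : bool := (box k).2 == row_start (box k).1.

Definition parallel (i j : nat) : bool :=
  (row_start i - i%:Z == row_start j - j%:Z) &&
  (row_end i - i%:Z == row_end j - j%:Z).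

Variables (K : fieldType) (q : K).
Implicit Types (x : 'I_degree -> K).

Definition chi_lam : 'I_degree -> K := fun k => q ^ content k.

Definition delta x : K :=
  \prod_(k < degree) \prod_(l < degree |
      [&& (k < l)%N, leftmost k, leftmost l & parallel (box k).1 (box l).1])
    (1 - x l / x k).

Definition F_lam x := forall k l, (box k).1 = (box l).1 ->
  x k * q ^ content l = q ^ content k * x l.

Definition is_E_lam (ks : seq 'I_degree.-1) (E : Hecke q degree) :=
  regular_value F_lam (@generic_point K degree)
    (fun x => delta x *: phi0 q ks x) chi_lam E.

End Diagrams.

Section ComplexRationalFunctions.
Variable R : realType.

Definition Cq : fieldType := {fraction {poly R[i]}}.

Definition q_ : Cq := tofrac 'X.

Lemma q_neq0 : q_ != 0.
Proof. by rewrite /q_ tofrac_eq0 polyX_eq0. Qed.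

End ComplexRationalFunctions.

(* Main.v *)
Require Import Defs.
From HB Require Import structures.
From mathcomp Require Import all_boot all_order all_algebra all_fingroup reals.
From mathcomp Require Import qpoly generic_quotient boolp monalg mpoly.
From mathcomp Require Import zify ring.

Set Implicit Arguments.
Unset Strict Implicit.
Unset Printing Implicit Defensive.
Import GRing.Theory.
Local Open Scope ring_scope.

(** Right multiplication by an element E of the Hecke algebra H is a map of
    modules I_chi -> I_chi' as soon as, in I_chi', each X_k acts on the vector E
    by the scalar chi(X_k).  The proof consists in checking these eigenvector
    equations.

    They are first turned into equations in H.  Moving X_k from the left of an
    element h of H to its right gives
      X_k h = \sum_j S(h)_{kj} X_j
    with coefficients S(h)_{kj} in H, and S, called [straighten] below, is an
    algebra morphism from H to the matrices over H.  Existence of S only requires the Hecke relations for the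
    matrices of the T_k ([hecke_mx_rel]), and the commutation rule follows for
    all h because T_1, ..., T_{n-1} generate H ([Xgen_straighten]).  So the
    equations for E become \sum_j chi'_j S(E)_{kj} = chi_k E, written
    [weight chi E chi'] below; these imply that right multiplication by E sends each
    generator X_k - chi_k of the left ideal of I_chi into the left ideal of I_chi'
    ([weight_intertwining]).

    Since S is multiplicative, weights compose ([weightM]).  Each factor
    phi_k(x) of phi_0 has weight (x, x o s_k) when x_k and x_{k+1} are distinct
    and x_k is not 0 ([weight_phi], a computation in rank two), so at a generic
    point x the product phi_0(x) has weight (x, x o w_0) ([weight_phi0]).

    The weight equations are polynomial in x once denominators are cleared, so
    they pass to the limit along the curve t |-> (t^i q^{c_k}), where i is the row
    of k.  This curve lies in F_lambda, goes through (q^{c_k}) at t = 1, and is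
    generic at t = q^m for all large m, because q is not a root of unity; and a
    polynomial with values in a vector space that vanishes at infinitely many
    points vanishes everywhere ([poly_fun_eq0]).  Multiplying by delta_lambda
    or by a denominator does not change a weight, hence E has weight
    (chi, chi o w_0).

    It remains to identify chi o w_0 with w_0 . chi = chi o w_0^-1: the longest
    element, characterised by its length, is an involution
    ([longest_elementV]), because length is the number of inversions. *)

(** * Length and inversions of permutations *)

Section Length.
Variable n : nat.
Implicit Types (w v : 'S_n) (k : 'I_n.-1) (ks : seq 'I_n.-1).

Lemma s_lo k : s_ k (lo k) = hi k. Proof. exact: tpermL. Qed.
Lemma s_hi k : s_ k (hi k) = lo k. Proof. exact: tpermR. Qed.

Lemma lo_neq_hi k : (lo k == hi k) = false.
Proof. by rewrite -val_eqE /= ltn_eqF. Qed.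

Lemma s_ltn k (a b : 'I_n) :
  (a < b)%N -> (a, b) != (lo k, hi k) -> (s_ k a < s_ k b)%N.
Proof.
rewrite /s_ xpair_eqE => ab abk.
have := erefl (val (lo k)); have := erefl (val (hi k)) => /=.
case: tpermP => [ea|ea|/eqP ea /eqP ea']; case: tpermP => [eb|eb|/eqP eb /eqP eb'];
  subst; rewrite -?val_eqE ?eqxx ?andbT //= in ab abk *; lia.
Qed.

(** The pairs of values, and not of positions, that appear in the wrong order:
    [word_perm] multiplies by s_k on the side of the values. *)
Definition inversions w : {set 'I_n * 'I_n} :=
  [set p : 'I_n * 'I_n | (p.1 < p.2)%N && (w^-1%g p.2 < w^-1%g p.1)%N].

Lemma inversions_mul_s w k :
  inversions (w * s_ k) :\ (lo k, hi k) =
  [set ((s_ k p.1, s_ k p.2) : 'I_n * 'I_n) |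
     p : 'I_n * 'I_n in inversions w :\ (lo k, hi k)].
Proof.
have sK := tpermK (lo k) (hi k).
have s_pair (p : 'I_n * 'I_n) : p != (lo k, hi k) -> (p.1 < p.2)%N ->
    ((s_ k p.1, s_ k p.2) != (lo k, hi k)) && (s_ k p.1 < s_ k p.2)%N.
  case: p => a b /= abk ab; rewrite s_ltn // andbT; apply/eqP => -[ea eb].
  move: ab; rewrite -(sK a) -(sK b) -/(s_ k) ea eb s_lo s_hi /=; lia.
apply/setP => -[a b]; rewrite !inE /= invMg !permM tpermV -/(s_ k).
apply/andP/imsetP => [[abk /andP[ab inv]]|[[c d]]].
  have /andP[abk' ab'] := s_pair (a, b) abk ab.
  exists (s_ k a, s_ k b); last by rewrite /= !sK.
  by rewrite !inE abk' ab' inv.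
rewrite !inE /= => /andP[cdk /andP[cd inv]] [-> ->].
by have /andP[-> ->] := s_pair (c, d) cdk cd; rewrite !sK.
Qed.

(** Apart from the pair (k, k+1), which changes status, s_k permutes the
    inversions: their number varies by exactly one. *)
Lemma card_inversions_mul_s w k :
  (#|inversions (w * s_ k)| + ((lo k, hi k) \in inversions w) =
   #|inversions w| + ((lo k, hi k) \notin inversions w))%N.
Proof.
rewrite (cardsD1 (lo k, hi k) (inversions (w * s_ k))).
rewrite (cardsD1 (lo k, hi k) (inversions w)) inversions_mul_s card_imset; last first.
  by move=> [a b] [c d] /= [/perm_inj -> /perm_inj ->].
have -> : ((lo k, hi k) \in inversions (w * s_ k)) =
          ((lo k, hi k) \notin inversions w).
  rewrite !inE /= invMg !permM tpermV tpermL tpermR ltnSn /= -leqNgt.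
  rewrite [RHS]leq_eqVlt; case: eqP => //= e.
  by have := congr1 val (perm_inj (val_inj e)) => /=; lia.
by case: (_ \in inversions w); rewrite /= add0n addn0 addnC.
Qed.

Lemma inversions1 : inversions 1 = set0.
Proof.
apply/setP => -[a b]; rewrite !inE invg1 !perm1 /= ltnNge.
by case: leqP => //; lia.
Qed.

Lemma card_inversions_word ks : (#|inversions (word_perm ks)| <= size ks)%N.
Proof.
elim: ks => [|k ks IH]; first by rewrite inversions1 cards0.
move: IH (card_inversions_mul_s (word_perm ks) k) => /=.
move: #|_| #|inversions (_ * _)| => a b; case: (_ \in _) => /=; lia.
Qed.

Lemma ltn_adjacent (f : 'I_n -> nat) :
  (forall k, (f (lo k) < f (hi k))%N) -> {homo f : i j / (i < j)%N >-> (i < j)%N}.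
Proof.
move=> f_lt i j; suff H m (l : 'I_n) : l = m :> nat -> (i < l)%N -> (f i < f l)%N.
  exact: H (erefl _).
elim: m l => [|m IH] l lm; rewrite lm // ltnS => im.
have mn : (m < n.-1)%N by rewrite -ltnS; have := ltn_ord l; rewrite lm; lia.
have -> : l = hi (Ordinal mn) by apply: val_inj; rewrite /= lm.
apply: leq_trans (f_lt _); rewrite ltnS.
move: im; rewrite leq_eqVlt => /orP[/eqP im|im].
  by have -> : i = lo (Ordinal mn) by apply: val_inj.
by apply: ltnW; apply: IH.
Qed.

Lemma leq_homo_ltn (f : 'I_n -> 'I_n) :
  {homo f : i j / (i < j)%N >-> (i < j)%N} -> forall i : 'I_n, (i <= f i)%N.
Proof.
move=> f_lt; case=> i; elim: i => // i IH i_lt.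
have i_n := ltnW i_lt; apply: leq_ltn_trans (IH i_n) _.
exact: f_lt.
Qed.

Lemma homo_ltn_id (f : 'I_n -> 'I_n) :
  {homo f : i j / (i < j)%N >-> (i < j)%N} -> f =1 id.
Proof.
move=> f_lt i; apply: val_inj; apply/eqP; rewrite eqn_leq (leq_homo_ltn f_lt) andbT.
(* Conjugating by the reversal turns the lower bound into an upper bound. *)
pose g j := rev_ord (f (rev_ord j)).
have /leq_homo_ltn/(_ (rev_ord i)) : {homo g : i j / (i < j)%N >-> (i < j)%N}.
  move=> a b ab; have := f_lt (rev_ord b) (rev_ord a); rewrite /=.
  have := ltn_ord (f (rev_ord a)); have := ltn_ord b; move: ab => /=; lia.
rewrite /g rev_ordK /=; have := ltn_ord (f i); have := ltn_ord i; lia.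
Qed.

(** Bubble sort: unless w = 1, some neighbouring values are inverted, and
    exchanging them removes one inversion.  With [card_inversions_word] this
    identifies the length with the number of inversions. *)
Lemma inversions_word w : exists2 ks, word_perm ks = w & size ks = #|inversions w|.
Proof.
suff H m v : #|inversions v| = m ->
    exists2 ks, word_perm ks = v & size ks = #|inversions v| by exact: H (erefl _).
elim: m v => {w} [|m IH] w wm.
  exists [::]; rewrite //=; apply/esym/invg_inj/permP => i; rewrite invg1 perm1.
  apply: homo_ltn_id; apply: ltn_adjacent => k.
  move/eqP: wm; rewrite cards_eq0 => /eqP/setP/(_ (lo k, hi k)).
  rewrite !inE /= ltnSn /= => /negbT; rewrite -leqNgt leq_eqVlt => /predU1P[e|//].
  by have := congr1 val (perm_inj (val_inj e)) => /=; lia.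
case: (pickP (fun k => (lo k, hi k) \in inversions w)) => [k kw|w0].
  have := card_inversions_mul_s w k; rewrite kw wm /= addn0 addn1 => -[ek].
  have [ks ksw ksm] := IH _ ek.
  exists (k :: ks); last by rewrite /= ksm ek.
  by rewrite /= ksw -mulgA tperm2 mulg1.
suff : inversions w = set0 by move=> e; rewrite e cards0 in wm.
apply/setP => -[a b]; rewrite !inE /=; apply/negbTE/andP => -[ab].
apply/negP; rewrite -leqNgt ltnW //.
move: a b ab; apply: ltn_adjacent => k; move: (w0 k); rewrite !inE /= ltnSn /=.
move/negbT; rewrite -leqNgt leq_eqVlt => /predU1P[e|//].
by have := congr1 val (perm_inj (val_inj e)) => /=; lia.
Qed.

(** If w has maximal length, then no s_k can lengthen it, so all neighbouring
    values are inverted and w is the order reversal. *)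
Lemma longest_elementV w ks :
  longest_element w -> reduced_decomposition w ks -> (w^-1 = w)%g.
Proof.
move=> wL wks.
have max_w v : (#|inversions v| <= #|inversions w|)%N.
  have [ls vls lsv] := inversions_word v; have [us wus <-] := inversions_word w.
  rewrite -lsv; apply: leq_trans (proj2 wks _ wus); apply: (wL v ks ls wks).
  by split=> // us' v_us; rewrite lsv -v_us card_inversions_word.
have w_dec k : (w^-1%g (hi k) < w^-1%g (lo k))%N.
  have := max_w (w * s_ k)%g; have := card_inversions_mul_s w k.
  move: #|inversions (_ * _)| #|inversions w| => a b.
  by case: (boolP (_ \in _)) => [|_] /=; rewrite ?inE /= ?ltnSn //=; lia.
have wE i : (w^-1)%g i = rev_ord i.
  rewrite -[LHS]rev_ordK; congr rev_ord.
  apply: (@homo_ltn_id (fun i => rev_ord ((w^-1)%g i))).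
  apply: (@ltn_adjacent (fun i => rev_ord ((w^-1)%g i))) => k.
  have := w_dec k; rewrite /=; have := ltn_ord (w^-1%g (lo k)); lia.
apply/permP => i; rewrite wE; apply: (@perm_inj _ w^-1%g).
by rewrite permK wE rev_ordK.
Qed.

End Length.

(** * Polynomial functions with values in a vector space *)

Section PolyFun.
Variables (K : fieldType) (V : lmodType K).

Definition poly_fun (f : K -> V) :=
  exists s : seq ({poly K} * V), forall t, f t = \sum_(p <- s) p.1.[t] *: p.2.

Lemma poly_fun_ext (f g : K -> V) : f =1 g -> poly_fun g -> poly_fun f.
Proof. by move=> fg [s gs]; exists s => t; rewrite fg. Qed.

Lemma poly_fun_sum (I : Type) (r : seq I) (f : I -> K -> V) :
  (forall i, poly_fun (f i)) -> poly_fun (fun t => \sum_(i <- r) f i t).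
Proof.
move=> fP; elim: r => [|i r [s rs]].
  by exists [::] => t; rewrite !big_nil.
have [u fu] := fP i; exists (u ++ s) => t.
by rewrite big_cons big_cat rs fu.
Qed.

Lemma poly_funZ (p : {poly K}) (f : K -> V) :
  poly_fun f -> poly_fun (fun t => p.[t] *: f t).
Proof.
move=> [s fs]; exists [seq (p * u.1, u.2) | u <- s] => t.
rewrite fs big_map scaler_sumr; apply: eq_bigr => u _.
by rewrite scalerA hornerM.
Qed.

Lemma poly_funC (v : V) : poly_fun (fun=> v).
Proof. by exists [:: (1, v)] => t; rewrite big_seq1 hornerC scale1r. Qed.

Lemma poly_funB (f g : K -> V) :
  poly_fun f -> poly_fun g -> poly_fun (fun t => f t - g t).
Proof.
move=> [s fs] [u gu]; exists (s ++ [seq (- p.1, p.2) | p <- u]) => t.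
rewrite big_cat big_map fs gu -sumrN; congr (_ + _).
by apply: eq_bigr => p _; rewrite hornerN scaleNr.
Qed.

(** Lagrange interpolation: on polynomials of degree less than d, evaluation at t
    is a linear combination of the evaluations at d distinct points, with
    coefficients that do not depend on the polynomial.  This works for
    all coefficient vectors at once, without coordinates in V. *)
Lemma poly_fun_eq0 (f : K -> V) (x : nat -> K) :
  poly_fun f -> injective x -> (forall i, f (x i) = 0) -> forall t, f t = 0.
Proof.
move=> [s fs] x_inj fx0 t.
(* A common bound on the sizes of the polynomials that occur in f. *)
pose d := (\max_(p <- s) size p.1).+1.
have pE p : p \in s -> p.1.[t] =
    \sum_(i < d) (tnth (lagrange d x) i : {poly K}).[t] * p.1.[x i].
  move=> ps; have sp : (size p.1 <= d)%N.
    apply: leqW.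
    exact: (@leq_bigmax_seq _ _ xpredT (fun u : {poly K} * V => size u.1) p ps).
  rewrite {1}(lagrange_gen (ltn0Sn _) x_inj sp) horner_sum.
  by apply: eq_bigr => i _; rewrite hornerM hornerC mulrC.
rewrite fs (eq_big_seq _ (fun p ps => congr1 (fun c => c *: p.2) (pE p ps))) /=.
under eq_bigr do rewrite scaler_suml.
rewrite exchange_big big1 // => i _; under eq_bigr do rewrite -scalerA.
by rewrite -scaler_sumr -fs fx0 scaler0.
Qed.

End PolyFun.

(** Restricted to a curve with polynomial coordinates, a polynomial function is
    polynomial in the parameter. *)
Lemma meval_horner (K : fieldType) n (P : mpoly n K) (h : 'I_n -> {poly K}) :
  exists p : {poly K}, forall t, P.@[fun i => (h i).[t]] = p.[t].
Proof.
exists (\sum_(m <- msupp P) P@_m *: \prod_i h i ^+ m i) => t.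
rewrite mevalE horner_sum; apply: eq_bigr => m _.
rewrite hornerZ horner_prod; congr (_ * _).
by apply: eq_bigr => i _; rewrite horner_exp.
Qed.

(** * A curve of generic points *)

Section DiagramPoints.
Variable lam : diagram.

Lemma size_boxes : size (boxes lam) = degree lam.
Proof.
rewrite /boxes size_flatten /shape -map_comp sumnE big_map.
by apply: eq_bigr => i _; rewrite /= size_map size_iota.
Qed.

Lemma boxes_uniq : uniq (boxes lam).
Proof.
apply: allpairs_uniq_dep => [|i _|]; rewrite ?iota_uniq //.
by move=> [i t] [j u] _ _ /= [-> /addrI[->]].
Qed.

Lemma box_inj : injective (@box lam).
Proof.
move=> k l /eqP; rewrite /box nth_uniq ?size_boxes ?boxes_uniq // => /eqP.
exact: val_inj.
Qed.

Variables (K : fieldType) (q : K).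
Hypothesis q_inj : injective (fun m : int => q ^ m).

(** Scaling each row separately moves freely in F_lambda; the exponents are chosen
    so that one parameter t separates all the rows. *)
Definition row_dilation (t : K) (k : 'I_(degree lam)) : K :=
  t ^+ (box k).1 * q ^ content k.

Lemma row_dilation1 : row_dilation 1 =1 chi_lam q.
Proof. by move=> k; rewrite /row_dilation expr1n mul1r. Qed.

Lemma row_dilation_F t : F_lam q (row_dilation t).
Proof. by move=> k l kl; rewrite /row_dilation kl mulrAC mulrC !mulrA. Qed.

(** At t = q^m the coordinates are q^(m i + c), with i the row and c the content.
    For m larger than all differences of contents, equality of two exponents
    forces first the rows and then the contents to agree. *)
Lemma row_dilation_generic (m : nat) :
  (\sum_(k < degree lam) 2 * `|content k| < m)%N ->
  generic_point (row_dilation (q ^+ m)).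
Proof.
move=> m_big; have q0 : q != 0.
  by apply/eqP => q0; have := @q_inj 1 2; rewrite q0 !exp0rz => /(_ erefl).
have xE k : row_dilation (q ^+ m) k = q ^ ((m * (box k).1)%:Z + content k).
  by rewrite /row_dilation expfzDr // -exprM.
split=> [k|k l]; first by rewrite xE expfz_neq0.
rewrite !xE => /q_inj.
(* The factor 2 in the hypothesis is what makes this hold for i = j too. *)
have small (i j : 'I_(degree lam)) : (`|content i| + `|content j| < m)%N.
  apply: leq_ltn_trans m_big.
  case: (eqVneq i j) => [<-|ij].
    by rewrite (bigD1 i) //= mul2n -addnn leq_addr.
  by rewrite (bigD1 i) // (bigD1 j) 1?eq_sym //=; lia.
case: (eqVneq (box k).1 (box l).1) => [e|ne] e'.
  apply: box_inj; move: e' e; rewrite /content.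
  case: (box k) (box l) => [i a] [j b] /=.
  by move=> e' e; congr (_, _) => //; move: e'; rewrite e => /addrI/addIr.
have := small k l; move: ne e'; move: (content _) (content _) => c c'.
move: (box k).1 (box l).1 => i j; nia.
Qed.

End DiagramPoints.

(** * Matrices over an algebra *)

Section MatrixAlgebra.
Variables (K : fieldType) (A : algType K) (m : nat).

(** An alias, because the canonical scalars of square matrices over A are in A,
    whereas the scalars of this algebra are in the ground field. *)
Definition mx_alg := 'M[A]_m.+1.
HB.instance Definition _ := GRing.NzRing.on mx_alg.

Definition mx_alg_scale (c : K) (M : mx_alg) : mx_alg := map_mx ( *:%R c) M.

Lemma mx_alg_scaleA c d M :
  mx_alg_scale c (mx_alg_scale d M) = mx_alg_scale (c * d) M.
Proof. by apply/matrixP => i j; rewrite !mxE scalerA. Qed.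
Lemma mx_alg_scale1 : left_id 1 mx_alg_scale.
Proof. by move=> M; apply/matrixP => i j; rewrite !mxE scale1r. Qed.
Lemma mx_alg_scaleDr : right_distributive mx_alg_scale +%R.
Proof. by move=> c M N; apply/matrixP => i j; rewrite !mxE scalerDr. Qed.
Lemma mx_alg_scaleDl M : {morph mx_alg_scale^~ M : c d / c + d}.
Proof. by move=> c d; apply/matrixP => i j; rewrite !mxE scalerDl. Qed.
HB.instance Definition _ := GRing.Zmodule_isLmodule.Build K mx_alg
  mx_alg_scaleA mx_alg_scale1 mx_alg_scaleDr mx_alg_scaleDl.

Lemma mx_alg_scaleAl c (M N : mx_alg) : c *: (M * N) = c *: M * N.
Proof.
apply/matrixP => i j; rewrite !mxE scaler_sumr.
by apply: eq_bigr => k _; rewrite mxE scalerAl.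
Qed.
Lemma mx_alg_scaleAr c (M N : mx_alg) : c *: (M * N) = M * (c *: N).
Proof.
apply/matrixP => i j; rewrite !mxE scaler_sumr.
by apply: eq_bigr => k _; rewrite mxE scalerAr.
Qed.
HB.instance Definition _ := GRing.Lmodule_isLalgebra.Build K mx_alg mx_alg_scaleAl.
HB.instance Definition _ := GRing.Lalgebra_isAlgebra.Build K mx_alg mx_alg_scaleAr.

Lemma mx_algZE c (M : mx_alg) i j : (c *: M) i j = c *: M i j.
Proof. exact: mxE. Qed.

Lemma mx_algDE (M N : mx_alg) i j : (M + N) i j = M i j + N i j.
Proof. exact: mxE. Qed.

Lemma mx_algME (M N : mx_alg) i j : (M * N) i j = \sum_l M i l * N l j.
Proof. exact: mxE. Qed.

Lemma mx_alg_sumE (I : Type) (r : seq I) (M : I -> mx_alg) i j :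
  (\sum_(u <- r) M u) i j = \sum_(u <- r) M u i j.
Proof. by elim/big_rec2: _ => [|u _ N _ <-]; rewrite mxE. Qed.

Lemma mx_algP (M N : mx_alg) : (forall i j, M i j = N i j) -> M = N.
Proof. by move=> MN; apply/matrixP. Qed.

End MatrixAlgebra.

(** * Induction on the generators of a Hecke algebra *)

Section Generation.
Variables (K : fieldType).

Lemma free_alg_ind (G : choiceType) (P : free_alg K G -> Prop) :
  P 1 -> (forall g, P (fgen K g)) ->
  (forall u v, P u -> P v -> P (u * v)) ->
  (forall u v, P u -> P v -> P (u + v)) ->
  (forall c u, P u -> P (c *: u)) -> forall u, P u.
Proof.
move=> P1 Pg PM PD PZ u.
have P0 : P 0 by rewrite -(scale0r 1); exact: PZ.
have Pw (m : {fmonom G}) : P (mkmalgU m 1).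
  case: m => s; elim: s => [|g s IH].
    by rewrite -fmE; exact: P1.
  have -> : mkmalgU (FMonom (g :: s)) 1 =
            fgen K g * mkmalgU (FMonom s) 1 :> free_alg K G.
    rewrite fgen.unlock [RHS]free_mulE [RHS]malgM_def fgmulUU mulr1 /fmu fmE.
    by congr mkmalgU; apply: val_inj; rewrite /= fmM.
  exact: PM.
have PU m c : P (mkmalgU m c).
  have -> : mkmalgU m c = c *: mkmalgU m 1 :> {malg K[{fmonom G}]}.
    by apply/malgP => k; rewrite [RHS]monalg.mcoeffZ !mcoeffU mulr_natr.
  exact: (PZ c (mkmalgU m 1)).
by rewrite (monalgE u); elim/big_ind: _.
Qed.

Lemma Hecke_ind (q : K) n (P : Hecke q n -> Prop) :
  P 1 -> (forall k, P (Tgen q k)) ->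
  (forall u v, P u -> P v -> P (u * v)) ->
  (forall u v, P u -> P v -> P (u + v)) ->
  (forall c u, P u -> P (c *: u)) -> forall h, P h.
Proof.
move=> P1 PT PM PD PZ h; rewrite -(alg_projK h); elim/free_alg_ind: (repr h) => //.
- by move=> u v Pu Pv; rewrite rmorphM; exact: PM.
- by move=> u v Pu Pv; rewrite rmorphD; exact: PD.
by move=> c u Pu; rewrite alg_proj_scalable; exact: PZ.
Qed.

End Generation.

(** * A matrix representation of the Hecke relations *)

Section HeckeMatrices.
Variables (K : fieldType) (q : K) (n : nat).
Variables (H : algType K) (T : 'I_n.+1.-1 -> H).
Hypothesis hT : forall u v, hecke_rel q T u v -> u = v.
Local Notation mxH := (mx_alg H n).
Implicit Types (k l : 'I_n.+1.-1) (M : mxH) (i j : 'I_n.+1).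

(** The coefficients of X_i T_k = \sum_j (hecke_mx k)_{ij} X_j in the affine Hecke
    algebra.  The entry T_k - (q - 1) is q T_k^-1. *)
Definition hecke_mx k : mxH := \matrix_(i, j)
  if i == lo k then (j == hi k)%:R * (T k - (q - 1)%:A)
  else if i == hi k then (j == lo k)%:R * T k + (j == hi k)%:R * (q - 1)%:A
  else (j == i)%:R * T k.

(** The action of hecke_mx k on a column.  The relations between the matrices are
    checked through it, so that only products in H are compared. *)
Definition col_op k (f : 'I_n.+1 -> H) i : H :=
  if i == lo k then (T k - (q - 1)%:A) * f (hi k)
  else if i == hi k then T k * f (lo k) + (q - 1) *: f (hi k)
  else T k * f i.

Lemma hecke_mx_mulE k M i j : (hecke_mx k * M) i j = col_op k (M^~ j) i.
Proof.
have sum_delta (c : H) a : \sum_l ((l == a)%:R * c) * M l j = c * M a j.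
  rewrite (bigD1 a) //= eqxx mul1r big1 ?addr0 // => l /negbTE->.
  by rewrite mul0r mul0r.
rewrite /col_op !mxE; under eq_bigr do rewrite mxE.
case: (i == lo k); first exact: sum_delta.
case: (i == hi k); last exact: sum_delta.
under eq_bigr do rewrite mulrDl.
by rewrite big_split /= !sum_delta mulr_algl.
Qed.

Lemma hecke_mx_mul2E k l M i j :
  (hecke_mx k * (hecke_mx l * M)) i j = col_op k (col_op l (M^~ j)) i.
Proof. by rewrite hecke_mx_mulE {1}/col_op !hecke_mx_mulE. Qed.

Lemma hecke_mx_mul3E k l M i j :
  (hecke_mx k * (hecke_mx l * (hecke_mx k * M))) i j =
  col_op k (col_op l (col_op k (M^~ j))) i.
Proof. by rewrite hecke_mx_mulE {1}/col_op !hecke_mx_mul2E. Qed.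

Lemma hecke_quadE (A : algType K) (t : A) :
  (t - q%:A) * (t + 1) = t * t - ((q - 1) *: t + q%:A).
Proof.
by rewrite mulrDr mulr1 mulrBl mulr_algl scalerBl scale1r !opprD opprK !addrA.
Qed.

Lemma hecke_sqr k : T k * T k = (q - 1) *: T k + q%:A.
Proof. by apply/eqP; rewrite -subr_eq0 -hecke_quadE (hT (hecke_quad _ _ k)). Qed.

Lemma hecke_mulVl k : (T k - (q - 1)%:A) * T k = q%:A.
Proof. by rewrite mulrBl mulr_algl hecke_sqr addrAC subrr add0r. Qed.

Lemma hecke_mulVr k : T k * (T k - (q - 1)%:A) = q%:A.
Proof. by rewrite mulrBr mulr_algr hecke_sqr addrAC subrr add0r. Qed.

Lemma hecke_mx_quad k : (hecke_mx k - q%:A) * (hecke_mx k + 1) = 0.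
Proof.
rewrite hecke_quadE; apply/eqP; rewrite subr_eq0; apply/eqP.
suff E M : hecke_mx k * (hecke_mx k * M) = (q - 1) *: (hecke_mx k * M) + q *: M.
  by have := E 1; rewrite !mulr1.
apply: mx_algP => i j; rewrite mx_algDE !mx_algZE hecke_mx_mul2E hecke_mx_mulE.
rewrite -[M i j]/((M^~ j) i); move: (M^~ j) => f; rewrite /col_op.
rewrite !eqxx [hi k == _]eq_sym !lo_neq_hi.
case: eqP => [->|_].
  by rewrite mulrDr mulrA hecke_mulVl mulr_algl -scalerAr addrC.
case: eqP => [->|_]; first by rewrite mulrA hecke_mulVr mulr_algl addrC.
by rewrite mulrA hecke_sqr mulrDl mulr_algl -scalerAl.
Qed.

Lemma hecke_mx_comm k l : (k.+1 < l)%N || (l.+1 < k)%N ->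
  hecke_mx k * hecke_mx l = hecke_mx l * hecke_mx k.
Proof.
move=> kl; have Tkl := hT (hecke_comm _ _ kl).
suff E M : hecke_mx k * (hecke_mx l * M) = hecke_mx l * (hecke_mx k * M).
  by have := E 1; rewrite !mulr1.
have TA k' l' c (x : H) : T k' * T l' = T l' * T k' ->
    (T k' - c%:A) * (T l' * x) = T l' * ((T k' - c%:A) * x).
  move=> e; rewrite !mulrA; congr (_ * x).
  by rewrite mulrBl mulrBr e mulr_algl mulr_algr.
have ll : (lo k == lo l) = false by move: kl; rewrite -val_eqE /= => /orP[]; lia.
have lh : (lo k == hi l) = false by move: kl; rewrite -val_eqE /= => /orP[]; lia.
have hl : (hi k == lo l) = false by move: kl; rewrite -val_eqE /= => /orP[]; lia.
have hh : (hi k == hi l) = false by move: kl; rewrite -val_eqE /= => /orP[]; lia.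
have [ll' lh' hl' hh'] : [/\ (lo l == lo k) = false, (lo l == hi k) = false,
    (hi l == lo k) = false & (hi l == hi k) = false].
  by split; rewrite eq_sym.
apply: mx_algP => i j; rewrite !hecke_mx_mul2E; move: (M^~ j) => f.
rewrite /col_op !(ll, lh, hl, hh, ll', lh', hl', hh').
case: (eqVneq i (lo k)) => [->|_]; first by rewrite ll lh TA.
case: (eqVneq i (hi k)) => [->|_].
  by rewrite hl hh mulrDr scalerAr !mulrA Tkl.
case: eqP => _; first by rewrite TA.
case: eqP => _; first by rewrite mulrDr scalerAr !mulrA Tkl.
by rewrite !mulrA Tkl.
Qed.

Lemma hecke_mx_braid k l : l = k.+1 :> nat ->
  hecke_mx k * hecke_mx l * hecke_mx k = hecke_mx l * hecke_mx k * hecke_mx l.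
Proof.
move=> kl; have Tkl := hT (hecke_braid _ _ kl).
suff E M : hecke_mx k * (hecke_mx l * (hecke_mx k * M)) =
           hecke_mx l * (hecke_mx k * (hecke_mx l * M)).
  by have := E 1; rewrite !mulr1 !mulrA.
have hk : hi k = lo l by apply: val_inj.
have ll : (lo k == lo l) = false by move: kl; rewrite -val_eqE /=; lia.
have lh : (lo k == hi l) = false by move: kl; rewrite -val_eqE /=; lia.
have lhl := lo_neq_hi l.
have [ll' lh' lhl'] : [/\ (lo l == lo k) = false, (hi l == lo k) = false &
    (hi l == lo l) = false].
  by split; rewrite eq_sym.
apply: mx_algP => i j; rewrite !hecke_mx_mul3E; move: (M^~ j) => f.
rewrite /col_op hk !eqxx !(ll, lh, lhl, ll', lh', lhl').
(* With T' = q T^-1 these are T_k' T_l' T_k = T_l T_k' T_l' and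
   T_k T_l T_k' = T_l' T_k T_l, two forms of the braid relation. *)
have Tkl0 : (T k - (q - 1)%:A) * (T l - (q - 1)%:A) * T k =
    T l * (T k - (q - 1)%:A) * (T l - (q - 1)%:A).
  transitivity (T k * T l * T k
                - (q - 1) *: (T l * T k) - (q - 1) *: q%:A).
    rewrite mulrBr mulrBl mulr_algr -scalerAl hecke_mulVl.
    by rewrite mulrBl mulrBl mulr_algl -scalerAl.
  rewrite [X in _ = X * _]mulrBr mulr_algr mulrBl mulrBr mulr_algr.
  by rewrite -scalerAl hecke_mulVr Tkl.
have Tkl1 : T k * T l * (T k - (q - 1)%:A) =
    (T l - (q - 1)%:A) * T k * T l.
  by rewrite mulrBr Tkl mulr_algr !mulrBl mulr_algl -scalerAl.
case: (eqVneq i (lo k)) => [->|ik]; rewrite ?ll ?lh.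
  by rewrite !mulrA Tkl0.
case: (eqVneq i (lo l)) => [_|il].
  by rewrite [in RHS]mulrDr [in RHS]mulrDr !mulrA Tkl1 -!scalerAr ?mulrA.
case: (eqVneq i (hi l)) => [_|ih]; last by rewrite !mulrA Tkl.
rewrite !mulrDr !scalerDr -!scalerAr !mulrA Tkl hecke_mulVr hecke_sqr.
rewrite mulrDl -scalerAl scalerDr -!addrA; congr (_ + _).
by rewrite addrA addrC.
Qed.

Lemma hecke_mx_rel (u v : mxH) : hecke_rel q hecke_mx u v -> u = v.
Proof.
case=> {u v} *; [exact: hecke_mx_braid | exact: hecke_mx_comm |].
exact: hecke_mx_quad.
Qed.

End HeckeMatrices.

(** * Moving the X_k to the right of the Hecke algebra *)

Section Pushing.
Variables (K : fieldType) (n : nat) (A B : algType K).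
Variables (iota : {lrmorphism A -> B}) (S : {lrmorphism A -> mx_alg A n}).
Variable X : 'I_n.+1 -> B.

Definition pushes (h : A) :=
  forall i, X i * iota h = \sum_j iota (S h i j) * X j.

Lemma pushes1 : pushes 1.
Proof.
move=> i; rewrite !rmorph1 mulr1 (bigD1 i) //= big1 => [|j ji].
  by rewrite mxE eqxx rmorph1 mul1r addr0.
by rewrite mxE eq_sym (negbTE ji) rmorph0 mul0r.
Qed.

(** Moving X past g and then past h multiplies the matrices of coefficients, which
    is why S has to be multiplicative. *)
Lemma pushesM g h : pushes g -> pushes h -> pushes (g * h).
Proof.
move=> Pg Ph i; rewrite rmorphM mulrA Pg mulr_suml.
under eq_bigr do rewrite -mulrA Ph mulr_sumr.
rewrite exchange_big; apply: eq_bigr => l _ /=.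
rewrite (rmorphM S) mx_algME rmorph_sum mulr_suml; apply: eq_bigr => j _.
by rewrite rmorphM mulrA.
Qed.

Lemma pushesD g h : pushes g -> pushes h -> pushes (g + h).
Proof.
move=> Pg Ph i; rewrite rmorphD mulrDr Pg Ph -big_split /=.
by apply: eq_bigr => j _; rewrite (rmorphD S) mx_algDE rmorphD mulrDl.
Qed.

Lemma pushesZ c h : pushes h -> pushes (c *: h).
Proof.
move=> Ph i; rewrite linearZ -scalerAr Ph scaler_sumr.
apply: eq_bigr => j _; rewrite [S (c *: h)]linearZ /= mx_algZE.
by rewrite [in RHS]linearZ scalerAl.
Qed.

Variables (q : K) (T : 'I_n.+1.-1 -> A) (T' : 'I_n.+1.-1 -> B).
Hypothesis q0 : q != 0.
Hypothesis hT' : forall u v, hecke_rel q T' u v -> u = v.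
Hypothesis iotaT : forall k, iota (T k) = T' k.
Hypothesis ST : forall k, S (T k) = hecke_mx q T k.
Hypothesis XT : forall k i, i != lo k -> i != hi k -> X i * T' k = T' k * X i.
Hypothesis TXT : forall k, T' k * X (lo k) * T' k = q *: X (hi k).

(** This rule and the next are T_k X_k T_k = q X_{k+1}, multiplied on the left and
    on the right by q T_k^-1 = T_k - (q - 1). *)
Lemma X_loT k : X (lo k) * T' k = (T' k - (q - 1)%:A) * X (hi k).
Proof.
apply: (scalerI q0); rewrite [in RHS]scalerAr -TXT !mulrA (hecke_mulVl hT').
by rewrite mulr_algl -scalerAl.
Qed.

Lemma X_hiT k : X (hi k) * T' k = T' k * X (lo k) + (q - 1) *: X (hi k).
Proof.
have E : T' k * X (lo k) = X (hi k) * (T' k - (q - 1)%:A).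
  apply: (scalerI q0); rewrite [in RHS]scalerAl -TXT -[RHS]mulrA (hecke_mulVr hT').
  by rewrite mulr_algr.
by rewrite E mulrBr mulr_algr subrK.
Qed.

Lemma pushesT k : pushes (T k).
Proof.
have iotaA c : iota c%:A = c%:A by exact: rmorph_alg.
have sum_delta (c : A) a : \sum_j iota ((j == a)%:R * c) * X j = iota c * X a.
  rewrite (bigD1 a) //= eqxx mul1r big1 ?addr0 // => l /negbTE->.
  by rewrite mul0r rmorph0 mul0r.
move=> i; rewrite iotaT ST; under eq_bigr do rewrite mxE.
case: (eqVneq i (lo k)) => [->|ilo].
  by rewrite sum_delta X_loT (rmorphB iota) /= iotaA iotaT.
case: (eqVneq i (hi k)) => [->|ihi].
  under eq_bigr do rewrite (rmorphD iota) mulrDl.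
  by rewrite big_split /= !sum_delta iotaT iotaA mulr_algl X_hiT.
by rewrite sum_delta iotaT XT.
Qed.

End Pushing.

Section HeckePushing.
Variables (K : fieldType) (q : K) (q0 : q != 0) (n : nat).
Local Notation H := (Hecke q n.+1).

Lemma Tgen_rel (x y : H) : hecke_rel q (@Tgen K q n.+1) x y -> x = y.
Proof.
have projT u v := @alg_proj_rel _ _ (hecke_relations q n.+1) u v.
case=> {x y} [k l kl|k l kl|k].
- by have := projT _ _ (hecke_braid _ _ kl); rewrite !rmorphM.
- by have := projT _ _ (hecke_comm _ _ kl); rewrite !rmorphM.
have := projT _ _ (hecke_quad _ _ k).
by rewrite rmorphM rmorphB rmorphD rmorph0 rmorph1 /= alg_proj_scalable rmorph1.
Qed.

Lemma straighten_respects :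
  respects (hecke_mx q (@Tgen K q n.+1)) (hecke_relations q n.+1).
Proof.
move=> u v uv; apply: (hecke_mx_rel Tgen_rel).
exact: (hecke_rel_morph (free_eval_gen (hecke_mx q (@Tgen K q n.+1))) uv).
Qed.

Definition straighten : H -> mx_alg H n := pres_lift straighten_respects.
HB.instance Definition _ := GRing.LRMorphism.on straighten.

Lemma straightenT k : straighten (Tgen q k) = hecke_mx q (@Tgen K q n.+1) k.
Proof. exact: pres_lift_gen. Qed.

Lemma hecke_to_affineT k :
  hecke_to_affine q0 (Tgen q k) = Taff q0 k :> AffineHecke q0 n.+1.
Proof. exact: pres_lift_gen. Qed.

Lemma Xgen_straighten (h : H) i :
  Xgen q0 i * hecke_to_affine q0 h =
  \sum_j hecke_to_affine q0 (straighten h i j) * Xgen q0 j.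
Proof.
suff P g : pushes (@hecke_to_affine K q q0 n.+1) straighten
                  (@Xgen K q q0 n.+1) g by exact: P.
have projT u v := @alg_proj_rel _ _ (affine_relations q0 n.+1) u v.
move: g; apply: Hecke_ind.
- exact: pushes1.
- move=> k; apply: (pushesT (q := q) (T := @Tgen K q n.+1)
                            (T' := @Taff K q q0 n.+1)) => //.
  + exact: Taff_rel.
  + exact: hecke_to_affineT.
  + exact: straightenT.
  + move=> l j il ih; have := projT _ _ (affine_XT _ _ _ _ il ih).
    by rewrite !rmorphM.
  move=> l; have := projT _ _ (affine_TXT _ _ _ _ l).
  by rewrite !rmorphM alg_proj_scalable.
- exact: pushesM.
- exact: pushesD.
exact: pushesZ.
Qed.

End HeckePushing.

(** * Weight equations *)

Section Weights.
Variables (K : fieldType) (q : K) (n : nat).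
Local Notation H := (Hecke q n.+1).
Implicit Types (x y z : 'I_n.+1 -> K) (g h : H).

(** In the module induced from y, the vector h is a common eigenvector of the
    X_i, with eigenvalues x i.  Stated in H itself, by means of [straighten], the
    condition is visibly bilinear in (x, y) and h. *)
Definition weight x h y := forall i, \sum_j y j *: straighten h i j = x i *: h.

Lemma sum_delta_scale y (h : H) i : \sum_j y j *: ((j == i)%:R * h) = y i *: h.
Proof.
rewrite (bigD1 i) //= eqxx mul1r big1 ?addr0 // => j /negbTE->.
by rewrite mul0r scaler0.
Qed.

Lemma straighten1 i j : straighten (1 : H) i j = (j == i)%:R.
Proof. by rewrite rmorph1 mxE eq_sym. Qed.

Lemma weight1 x : weight x 1 x.
Proof.
move=> i; rewrite -[RHS]sum_delta_scale; apply: eq_bigr => j _.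
by rewrite straighten1 mulr1.
Qed.

(** Composition of intertwining operators: g and h are the images of the cyclic
    vectors. *)
Lemma weightM x g y h z : weight x g y -> weight y h z -> weight x (g * h) z.
Proof.
move=> gW hW i; rewrite scalerAl -gW mulr_suml.
under eq_bigr do rewrite rmorphM mx_algME scaler_sumr.
rewrite exchange_big; apply: eq_bigr => l _ /=.
rewrite -scalerAl scalerAr -hW mulr_sumr.
by apply: eq_bigr => j _; rewrite scalerAr.
Qed.

Lemma weightZ c x h y : weight x h y -> weight x (c *: h) y.
Proof.
move=> hW i; rewrite scalerA mulrC -scalerA -hW scaler_sumr.
by apply: eq_bigr => j _; rewrite linearZ /= mx_algZE !scalerA mulrC.
Qed.

(** Outside rows k and k+1 the matrix of T_k is scalar and x o s_k agrees with x.
    In these two rows the terms in T_k match, and the remaining scalars give the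
    same equation on the bracket. *)
Lemma weight_phi k x : x (lo k) != 0 -> x (lo k) != x (hi k) ->
  weight x (phi q k x) (fun i => x (s_ k i)).
Proof.
move=> x0 xx i; rewrite /phi; set c := bracket _ _.
(* This identity is what determines the scalar added to T_k in phi_k. *)
have cE : c * x (hi k) = x (lo k) * (q - 1) + c * x (lo k).
  by rewrite /c /bracket; field; rewrite x0 subr_eq0 xx.
have SE j : straighten (Tgen q k + c%:A) i j =
    hecke_mx q (@Tgen K q n.+1) k i j + (j == i)%:R * c%:A.
  rewrite (rmorphD (@straighten K q n)) /= mx_algDE straightenT.
  by rewrite linearZ /= mx_algZE straighten1 mulr_algr.
under eq_bigr do rewrite SE scalerDr.
rewrite big_split sum_delta_scale /=; under eq_bigr do rewrite mxE.
case: (eqVneq i (lo k)) => [->|ilo].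
  rewrite sum_delta_scale s_lo s_hi scalerBr scalerDr -addrA; congr (_ + _).
  have loE (V : lmodType K) (v : V) :
      - (x (lo k) *: ((q - 1) *: v)) + x (hi k) *: (c *: v) = x (lo k) *: (c *: v).
    by rewrite !scalerA [x (hi k) * c]mulrC cE scalerDl addKr [c * _]mulrC.
  exact: loE.
case: (eqVneq i (hi k)) => [->|ihi].
  under eq_bigr do rewrite scalerDr.
  rewrite big_split /= !sum_delta_scale s_lo s_hi scalerDr -addrA; congr (_ + _).
  have hiE (V : lmodType K) (v : V) :
      x (lo k) *: ((q - 1) *: v) + x (lo k) *: (c *: v) = x (hi k) *: (c *: v).
    by rewrite !scalerA -scalerDl [x (lo k) * c]mulrC -cE mulrC.
  exact: hiE.
by rewrite sum_delta_scale /s_ tpermD 1?eq_sym // scalerDr.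
Qed.

Lemma phi0_cons m (k : 'I_m.-1) ks (x : 'I_m -> K) :
  phi0 q (k :: ks) x = phi q k x * phi0 q ks (fun i => x (s_ k i)).
Proof.
rewrite /phi0 [LHS]big_ord_recl.
rewrite /twist; apply: (congr2 *%R).
  by rewrite /phi !perm1.
apply: eq_bigr => j _; rewrite (tnth_nth k) [in RHS](tnth_nth k).
by rewrite /phi !permM.
Qed.

Lemma weight_phi0 ks x :
  generic_point x -> weight x (phi0 q ks x) (fun i => x (word_perm ks i)).
Proof.
elim: ks x => [|k ks IH] x [x0 x_inj].
  rewrite /phi0 big_ord0 (_ : (fun _ => _) = x); first exact: weight1.
  by apply: funext => i; rewrite perm1.
rewrite phi0_cons; apply: (weightM (y := fun i => x (s_ k i))).
  by apply: weight_phi; rewrite ?x0 // (inj_eq x_inj) lo_neq_hi.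
have -> : (fun i => x (word_perm (k :: ks) i)) = fun i => x (s_ k (word_perm ks i)).
  by apply: funext => i; rewrite permM.
by apply: (IH (fun i => x (s_ k i))); split=> // i j /x_inj/perm_inj.
Qed.

(** The characters at both ends vary with the parameter, but each weight equation
    compares two polynomial functions with values in H. *)
Lemma weight_density (x : 'I_n.+1 -> {poly K}) (P : seq (mpoly n.+1 K * H))
    (w : 'S_n.+1) (a : nat -> K) :
  let xt t i := (x i).[t] in
  let h t := \sum_(u <- P) u.1.@[xt t] *: u.2 in
  injective a ->
  (forall m, weight (xt (a m)) (h (a m)) (fun i => xt (a m) (w i))) ->
  forall t, weight (xt t) (h t) (fun i => xt t (w i)).
Proof.
move=> xt h a_inj hW t i; apply/eqP; rewrite -subr_eq0; apply/eqP.
have P_poly (f : H -> H) : poly_fun (fun s => \sum_(u <- P) u.1.@[xt s] *: f u.2).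
  apply: poly_fun_sum => u; have [p pE] := meval_horner u.1 x.
  apply: (poly_fun_ext (g := fun s => p.[s] *: f u.2)) => [s|]; first by rewrite -pE.
  exact: poly_funZ (poly_funC _).
apply: (poly_fun_eq0 (f := fun s =>
  \sum_j xt s (w j) *: straighten (h s) i j - xt s i *: h s) _ a_inj).
  apply: poly_funB.
    apply: poly_fun_sum => j; apply: poly_funZ.
    apply: (poly_fun_ext _ (P_poly (fun g => straighten g i j))) => s.
    rewrite linear_sum mx_alg_sumE; apply: eq_bigr => u _.
    by rewrite linearZ /= mx_algZE.
  by apply: poly_funZ; exact: (P_poly id).
by move=> m; apply/eqP; rewrite subr_eq0; apply/eqP; exact: hW.
Qed.

End Weights.

(** * From weights to intertwining operators *)

Section LeftQuotientMul.
Variables (A : nzRingType) (S S' : A -> Prop) (E : A).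
Hypothesis SE : forall a, S a -> a * E \in left_ideal S'.

(** The hypothesis is an argument of the map, which is additive only under it: the
    representative chosen by [repr] must not matter. *)
Definition left_quot_mulr of forall a, S a -> a * E \in left_ideal S' :=
  fun u : left_quot S => left_proj S' (repr u * E).
Local Notation mulE := (left_quot_mulr SE).

Lemma left_quot_mulrE a : mulE (left_proj S a) = left_proj S' (a * E).
Proof.
apply/left_projP; rewrite -mulrBl.
have /left_projP/asboolP[s [sS ->]] := left_projK (left_proj S a).
rewrite mulr_suml big_seq; apply: rpred_sum => t /sS/SE tE.
by rewrite -mulrA; apply: left_idealM.
Qed.

Lemma left_quot_mulr_zmod : zmod_morphism mulE.
Proof.
move=> u v; rewrite -(left_projK u) -(left_projK v) -raddfB !left_quot_mulrE.
by rewrite mulrBl raddfB.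
Qed.

Lemma left_quot_mulr_scalable : scalable mulE.
Proof.
have scaleE (S0 : A -> Prop) (a b : A) : a *: left_proj S0 b = left_proj S0 (a * b).
  exact: left_scaleE.
move=> a u; rewrite -(left_projK u) scaleE !left_quot_mulrE scaleE.
by rewrite mulrA.
Qed.

HB.instance Definition _ := GRing.isZmodMorphism.Build (left_quot S) (left_quot S')
  mulE left_quot_mulr_zmod.
HB.instance Definition _ := GRing.isScalable.Build A (left_quot S) (left_quot S')
  *:%R mulE left_quot_mulr_scalable.

End LeftQuotientMul.

Section Intertwining.
Variables (K : fieldType) (q : K) (q0 : q != 0).

Lemma intertwining_mulr n (chi chi' : 'I_n -> K) (E : Hecke q n) :
  (forall k, (Xgen q0 k - (chi k)%:A) * hecke_to_affine q0 E \in
     left_ideal (fun a => exists k, a = Xgen q0 k - (chi' k)%:A)) ->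
  intertwining q0 chi chi' (fun h => h * E).
Proof.
move=> EW.
have SE a : (exists k, a = Xgen q0 k - (chi k)%:A) -> a * hecke_to_affine q0 E \in
     left_ideal (fun a => exists k, a = Xgen q0 k - (chi' k)%:A).
  by move=> [k ->]; exact: EW.
exists (left_quot_mulr SE) => h.
rewrite /hecke_to_induced /= (left_quot_mulrE SE).
by rewrite -rmorphM.
Qed.

(** X_k E - x_k E = \sum_j S(E)_{kj} (X_j - y_j) lies in the left ideal that
    defines the module induced from y. *)
Lemma weight_intertwining n (x y : 'I_n.+1 -> K) (E : Hecke q n.+1) :
  weight x E y -> intertwining q0 x y (fun h => h * E).
Proof.
move=> EW; apply: intertwining_mulr => k.
rewrite mulrBl mulr_algl Xgen_straighten -linearZ /= -EW.
rewrite (linear_sum (@hecke_to_affine K q q0 n.+1)) -sumrB.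
apply: rpred_sum => j _; rewrite linearZ /= -mulr_algr -mulrBr; apply: left_idealM.
apply/asboolP; exists [:: (1, Xgen q0 j - (y j)%:A)]; split.
  by move=> t; rewrite inE => /eqP-> /=; exists j.
by rewrite big_seq1 mul1r.
Qed.

(** Up to the nonzero factor Q p, the value at p is the limit, along the curve x, of
    the multiples Q d phi_0 of phi_0 at generic points, which have the right
    weight. *)
Lemma regular_value_intertwining n (ks : seq 'I_n.-1) F (d : ('I_n -> K) -> K)
    (x : 'I_n -> {poly K}) (a : nat -> K) t (p : 'I_n -> K) (E : Hecke q n) :
  injective a ->
  (forall m, F (fun i => (x i).[a m])) ->
  (forall m, generic_point (fun i => (x i).[a m])) ->
  (fun i => (x i).[t]) = p ->
  regular_value F (@generic_point K n) (fun y => d y *: phi0 q ks y) p E ->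
  intertwining q0 p (fun i => p (word_perm ks i)) (fun h => h * E).
Proof.
case: n => [|n] in ks F d x p E *.
  (* There is no X_k in degree 0. *)
  by move=> *; apply: intertwining_mulr => -[].
move=> a_inj aF a_gen xp [Q [P [Qp PE EP]]]; apply: weight_intertwining.
rewrite -[E](scalerK Qp); apply: weightZ; rewrite EP -xp.
apply: (weight_density a_inj) => m; rewrite -PE //.
by apply: weightZ; apply: weightZ; exact: weight_phi0.
Qed.

End Intertwining.

(** * The case of a diagram *)

Lemma q_exprz_inj (R : realType) : injective (fun m : int => q_ R ^ m).
Proof.
have q0 := q_neq0 R.
have pos (d : nat) : q_ R ^+ d = 1 -> d = 0%N.
  rewrite /q_ -tofracXn -tofrac1 => /eqP; rewrite tofrac_eq => /eqP.
  move/(congr1 (fun p : {poly _} => size p)).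
  by rewrite size_polyXn size_poly1 => -[].
have main (d : int) : q_ R ^ d = 1 -> d = 0.
  case: d => d; first by move=> /pos->.
  rewrite NegzE -invr_expz => /(congr1 (@GRing.inv _)).
  by rewrite invrK invr1 => /pos.
move=> m1 m2 /= e; apply/eqP; rewrite -subr_eq0; apply/eqP; apply: main.
by rewrite expfzDr // -invr_expz e mulfV // expfz_neq0.
Qed.

Theorem corollary8 (R : realType) (lam : diagram)
    (w0 : 'S_(degree lam)) (ks : seq 'I_(degree lam).-1)
    (E : Hecke (q_ R) (degree lam)) :
  cherednik lam ->
  longest_element w0 ->
  reduced_decomposition w0 ks ->
  is_E_lam ks E ->
  intertwining (q_neq0 R)
    (chi_lam (q_ R)) (char_act w0 (chi_lam (q_ R)))
    (fun h => h * E).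
Proof.
move=> _ w0L ksR EE; have [ksw _] := ksR.
have q_inj := @q_exprz_inj R.
pose N := (\sum_(k < degree lam) 2 * `|content k|)%N.
pose x (k : 'I_(degree lam)) : {poly Cq R} := q_ R ^ content k *: 'X^((box k).1).
have xE t : (fun k => (x k).[t]) = row_dilation (q_ R) t.
  by apply: funext => k; rewrite /x hornerZ hornerXn mulrC.
rewrite (_ : char_act w0 _ = fun i => chi_lam (q_ R) (word_perm ks i)); last first.
  by rewrite /char_act (longest_elementV w0L ksR) ksw.
(* The exponents N + m + 1 exceed the bound above which the points are generic. *)
apply: (regular_value_intertwining (q_neq0 R) (x := x) (t := 1)
  (a := fun m => q_ R ^+ (N + m).+1) _ _ _ _ EE) => [m1 m2|m|m|].
- by rewrite !exprnP => /q_inj[] /addnI.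
- by rewrite xE; exact: row_dilation_F.
- by rewrite xE; apply: row_dilation_generic => //; rewrite ltnS leq_addr.
by rewrite xE; apply: funext; exact: row_dilation1.
Qed.
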